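(* Let $\alpha,\kappa\in\mathbb{Z}^+$ with $\kappa<p_\alpha$, and for $n\in\mathbb{Z}^+$ let $$\gamma_n=\frac{2\,n\,p_{\alpha+\lfloor n/\kappa\rfloor}}{p_{\alpha+\lfloor n/\kappa\rfloor}-n+\kappa\lfloor n/\kappa\rfloor}\prod_{i=0}^{\lfloor n/\kappa\rfloor-1}\frac{p_{\alpha+i}}{p_{\alpha+i}-\kappa}.$$ Then $\gamma_n=o(n^2)$ as $n\to\infty$.
   Context: $p_k$ denotes the $k$-th prime; an empty product equals $1$. *)

(* Defs.v *)
From mathcomp Require Import all_boot all_order all_algebra.
From mathcomp Require Import all_classical all_reals all_analysis.

Set Implicit Arguments.
Unset Strict Implicit.
Unset Printing Implicit Defensive.

Import Order.TTheory GRing.Theory Num.Theory.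
Import numFieldNormedType.Exports.

Lemma ex_prime_gt (m : nat) : exists p, (m < p)%N && prime p.
Proof. by have [p mp pp] := prime_above m; exists p; rewrite mp pp. Qed.

Definition next_prime (m : nat) : nat := ex_minn (ex_prime_gt m).

(* Indexing starts at 1, so that nth_prime 1 = 2, nth_prime 2 = 3;
   nth_prime 0 = 0 is a junk value. *)
Definition nth_prime (k : nat) : nat := iter k next_prime 0.

(* %/ on nat is the floor of the quotient. All other operations are in R, since
   the truncated subtraction of nat would not do in the denominators. *)
Definition gamma_seq (R : realType) (alpha kappa n : nat) : R :=
  let m := (n %/ kappa)%N in
  let p i : R := (nth_prime (alpha + i))%:R%R in
  ((2 * n%:R * p m) / (p m - n%:R + kappa%:R * m%:R)
   * \prod_(0 <= i < m) (p i / (p i - kappa%:R)))%R.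

(* Main.v *)
Require Import Defs.
From mathcomp Require Import all_boot all_order all_algebra.
From mathcomp Require Import all_classical all_reals all_analysis.
From mathcomp Require Import zify ring lra.
Import Order.TTheory GRing.Theory Num.Theory.
Import numFieldNormedType.Exports.
Local Open Scope classical_set_scope.
Local Open Scope ring_scope.

(** Write [n = m * kappa + r] with [r < kappa]. The denominator of the leading
    fraction of gamma_n is [p - r] with [p > kappa], so that fraction is at
    most [2 n (kappa + 1)], and gamma_n = o(n^2) reduces to showing that the
    product [P m] of the [p_i / (p_i - kappa)] over [i < m], where [p_i] is the
    [(alpha + i)]-th prime, is o(m), since [m <= n]. By Mertens'
    theorem this product grows like a power of log m, but far less is enough: if [p_i >= 2 kappa (i + 1)] for all large [i], then the
    square of the [i]-th factor is at most [(i + 1) / i], so [P m ^+ 2 / m] is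
    eventually nonincreasing and [P m = O(sqrt m)]
    ([prod_ratio_sublinear]).

    It remains to see that the [k]-th prime [q_k] eventually exceeds any linear
    function of [k] ([nth_prime_superlinear]), that is, that the primes have
    density zero. As the [k]-th prime is at least [k], the product of the
    primes up to it is at least [k!]; by Chebyshev's and Erdos' argument the
    product of the primes up to [n] is at most [4 ^ n] ([primorial_le]). Thus
    [k! <= 4 ^ q_k], and a bound [q_k < C k] would give [k! <= (4 ^ C) ^ k],
    which is false for large [k]. *)

Section PrimeGrowth.
Local Open Scope nat_scope.

Lemma prime_dvd_fact (p n : nat) : prime p -> (p %| n`!) = (p <= n).
Proof.
move=> p_pr; apply/idP/idP; last first.
  by move=> le_pn; apply: dvdn_fact; rewrite prime_gt0.
elim: n => [|n IHn]; first by rewrite fact0 Euclid_dvd1.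
by rewrite factS Euclid_dvdM // => /orP[/dvdn_leq-> // | /IHn /leqW].
Qed.

(** All these primes divide the numerator of the central binomial coefficient
    [(2m+1)! / (m! (m+1)!)] and none divides its denominator, so their product
    divides it. This coefficient occurs twice in the expansion of
    [(1 + 1) ^ (2m+1)], hence is at most [2 ^ (2m)]. *)
Lemma prod_primes_central_le (m : nat) :
  \prod_(m.+2 <= p < m.*2.+2 | prime p) p <= 4 ^ m.
Proof.
have le_m : m <= m.*2.+1 by lia.
have subm : m.*2.+1 - m = m.+1 by lia.
apply: (@leq_trans 'C(m.*2.+1, m)).
  apply: dvdn_leq; first by rewrite bin_gt0.
  apply/unstable.Gauss_dvd_prod.
    rewrite map_id; apply: (@sub_in_pairwise _ prime [rel p q | p != q]).
    - move=> p q p_pr q_pr /=; rewrite !unfold_in in p_pr q_pr.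
      by rewrite prime_coprime // dvdn_prime2.
    - exact: filter_all.
    - by rewrite -uniq_pairwise filter_uniq // iota_uniq.
  move=> p; rewrite mem_index_iota => /andP[lt_mp lt_pm] p_pr.
  have : p %| (m.*2.+1)`! by rewrite prime_dvd_fact.
  rewrite -(bin_fact le_m) subm 2?Euclid_dvdM // !prime_dvd_fact //.
  by case/or3P=> // le_p; exfalso; move: lt_mp le_p; clear; lia.
have bin_sym : 'C(m.*2.+1, m.+1) = 'C(m.*2.+1, m) by rewrite -subm bin_sub.
have : 'C(m.*2.+1, m) + 'C(m.*2.+1, m.+1) <= 2 ^ m.*2.+1.
  rewrite -[2]/(1 + 1) expnDn.
  under eq_bigr do rewrite !exp1n !muln1.
  have lt_m : m < m.*2.+2 by lia.
  have lt_m1 : m.+1 < m.*2.+2 by lia.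
  rewrite (bigD1 (Ordinal lt_m)) //= (bigD1 (Ordinal lt_m1)) /=; last first.
    by rewrite -val_eqE /=; lia.
  by rewrite addnA leq_addr.
by rewrite bin_sym addnn expnS mul2n leq_double -mul2n expnM.
Qed.

(** Strong induction: apart from [n = 2], only an odd prime [n = 2m+1] needs an
    argument, and there
    the primes up to [m+1] contribute at most [4 ^ (m+1)] and the others at
    most [4 ^ m]. *)
Lemma primorial_le (n : nat) : \prod_(0 <= p < n.+1 | prime p) p <= 4 ^ n.
Proof.
elim/ltn_ind: n => n IHn.
case: n IHn => [|n] IHn; first by rewrite big_mkcond big_nat1.
have [] := boolP (prime n.+1); last first.
  move=> npr; rewrite big_mkcond big_nat_recr //= (negPf npr) muln1 -big_mkcond.
  by apply: leq_trans (IHn n _) _ => //; rewrite leq_exp2l.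
move=> pr; have [n1|n_neq1] := eqVneq n 1.
  by rewrite n1 unlock.
case/even_prime: (pr) => [|n_odd]; first by lia.
have [m nE] : exists m, n.+1 = m.*2.+1 by exists n./2; move: n_odd => /=; lia.
have m_gt0 : 0 < m by have := prime_gt1 pr; lia.
rewrite nE (@big_cat_nat _ _ _ m.+2) //=; [|lia].
have -> : m.*2.+1 = m.+1 + m by lia.
rewrite expnD leq_mul //; first by apply: IHn; lia.
by rewrite addSn addnn prod_primes_central_le.
Qed.

(** With [B = 2M], every factor of [k!] beyond the first [B] is at least [B], so
    [B ^ k <= k! * B ^ B]; the spare factor [2 ^ k] eventually beats the
    constant [B ^ B]. *)
Lemma expn_lt_fact (M : nat) : 0 < M ->
  exists N, forall k, N <= k -> M ^ k < k`!.
Proof.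
move=> M_gt0; set B := M.*2; exists (B ^ B) => k le_k.
have B_gt0 : 0 < B by lia.
have le_fact j : B ^ j <= j`! * B ^ B.
  elim: j => [|j IHj]; first by rewrite fact0 mul1n expn_gt0 B_gt0.
  have [lt_jB|le_Bj] := ltnP j B.
    by rewrite -[leqLHS]mul1n leq_mul ?fact_gt0 // leq_pexp2l.
  by rewrite expnS factS -mulnA leq_mul // leqW.
have lt_k : B ^ B < 2 ^ k by apply: leq_ltn_trans le_k (ltn_expl _ _).
rewrite ltnNge; apply/negP => le_M.
have : k`! * B ^ B < M ^ k * 2 ^ k.
  apply: (@leq_ltn_trans (M ^ k * B ^ B)); first by rewrite leq_mul2r le_M orbT.
  by rewrite ltn_pmul2l // expn_gt0 M_gt0.
by rewrite -expnMn muln2 ltnNge le_fact.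
Qed.

Lemma next_prime_gt (m : nat) : m < next_prime m.
Proof. by rewrite /next_prime; case: ex_minnP => p /andP[]. Qed.

Lemma next_prime_prime (m : nat) : prime (next_prime m).
Proof. by rewrite /next_prime; case: ex_minnP => p /andP[]. Qed.

Lemma nth_primeS (k : nat) : nth_prime k.+1 = next_prime (nth_prime k).
Proof. by []. Qed.

Lemma leq_nth_prime (k : nat) : k <= nth_prime k.
Proof.
by elim: k => // k IHk; rewrite nth_primeS (leq_trans _ (next_prime_gt _)).
Qed.

Lemma nth_prime_homo : {homo nth_prime : i j / i <= j}.
Proof.
apply: homo_leq => [//|x y z|k]; first exact: leq_trans.
by rewrite nth_primeS ltnW // next_prime_gt.
Qed.

Lemma fact_le_primorial (k : nat) :
  k`! <= \prod_(0 <= p < (nth_prime k).+1 | prime p) p.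
Proof.
elim: k => [|k IHk]; first by rewrite big_mkcond big_nat1.
rewrite factS mulnC nth_primeS big_mkcond big_nat_recr //= -big_mkcond /=.
rewrite next_prime_prime leq_mul //; last first.
  by rewrite -nth_primeS leq_nth_prime.
apply: leq_trans IHk _.
rewrite [leqRHS](@big_cat_nat _ _ _ (nth_prime k).+1) ?next_prime_gt //=.
by rewrite leq_pmulr // prodn_cond_gt0 // => p /prime_gt0.
Qed.

(** Otherwise [k! <= 4 ^ nth_prime k <= (4 ^ C) ^ k] for arbitrarily large
    [k]. *)
Lemma nth_prime_superlinear (C : nat) :
  exists N, forall k, N <= k -> C * k <= nth_prime k.
Proof.
have [N HN] := @expn_lt_fact (4 ^ C) (expn_gt0 4 C).
exists N => k /HN; apply: contraLR; rewrite -ltnNge -leqNgt => lt_p.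
apply: leq_trans (fact_le_primorial k) _.
by apply: leq_trans (primorial_le _) _; rewrite -expnM leq_exp2l // ltnW.
Qed.

End PrimeGrowth.

(** The constant [2 * kappa] makes the [i]-th factor at most
    [1 + 1 / (2 i + 1)], whose square is at most [1 + 1 / i]. These bounds
    telescope, so the product is O(sqrt m), hence eventually below [eps * m]. *)
Lemma prod_ratio_sublinear (R : realType) (kappa : nat) (p : nat -> nat) :
  (forall i, kappa < p i)%N ->
  (exists N, forall i, N <= i -> 2 * kappa * i.+1 <= p i)%N ->
  forall eps : R, 0 < eps -> exists N, forall m, (N <= m)%N ->
    \prod_(0 <= i < m) ((p i)%:R / ((p i)%:R - kappa%:R)) <= eps * m%:R.
Proof.
move=> lt_p [N0 le_p] eps eps_gt0.
pose rho i : R := (p i)%:R / ((p i)%:R - kappa%:R).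
pose P m : R := \prod_(0 <= i < m) rho i.
have d_gt0 i : 0 < (p i)%:R - kappa%:R :> R by rewrite subr_gt0 ltr_nat.
have rho_ge0 i : 0 <= rho i by rewrite divr_ge0 // ltW.
have P_ge0 m : 0 <= P m by rewrite prodr_ge0.
have rho_sq i : (N0 <= i)%N -> rho i ^+ 2 * i%:R <= i.+1%:R.
  move=> /le_p; rewrite -(ler_nat R) !natrM -[i.+1%:R]natr1 => le_pi.
  rewrite /rho expr_div_n mulrAC ler_pdivrMr ?exprn_gt0 //.
  have := d_gt0 i; move: le_pi.
  have : 0 <= kappa%:R :> R by [].
  have : 0 <= i%:R :> R by [].
  move: (p i)%:R kappa%:R i%:R => x k t t_ge0 k_ge0 le_x d_gt0'.
  (* With d = x - k, the claim (d + k)^2 t <= (t + 1) d^2 amounts to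
     2 d k t + k^2 t <= d^2, which follows from k (2 t + 1) <= d used once
     against d and once against k. *)
  have le_d : k * (2 * t + 1) <= x - k by lra.
  have le_dd : (x - k) * (k * (2 * t + 1)) <= (x - k) * (x - k).
    by rewrite ler_pM2l.
  have le_kd : k * (k * (2 * t + 1)) <= k * (x - k) by apply: ler_wpM2l.
  have kkt_ge0 : 0 <= k * k * t by rewrite !mulr_ge0.
  have kk_ge0 : 0 <= k * k by rewrite mulr_ge0.
  by lra.
(* Starting at N0 + 1 rather than N0 makes the base case N >= 1. *)
pose N := N0.+1; pose K := P N ^+ 2.
have P_sq m : (N <= m)%N -> P m ^+ 2 <= K * m%:R.
  elim: m => [//|m IHm]; rewrite leq_eqVlt => /predU1P[<-|le_m].
    by rewrite -[leLHS]mulr1 ler_wpM2l ?sqr_ge0 // ler1n.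
  rewrite /P big_nat_recr //= -/(P m) exprMn.
  apply: (@le_trans _ _ (K * m%:R * rho m ^+ 2)).
    by rewrite ler_wpM2r ?sqr_ge0 // IHm.
  rewrite -mulrA ler_wpM2l ?sqr_ge0 // mulrC rho_sq //.
  exact: ltnW.
(* K m <= (eps m)^2 as soon as m >= K / eps^2. *)
exists (maxn N (Num.bound (K / eps ^+ 2))) => m.
rewrite geq_max => /andP[le_N le_b].
rewrite -[leLHS]/(P m) -ler_sqr ?nnegrE ?mulr_ge0 //; last exact: ltW.
apply: le_trans (P_sq _ le_N) _; rewrite exprMn [_%:R ^+ 2]expr2 mulrA.
rewrite ler_wpM2r // mulrC -ler_pdivrMr ?exprn_gt0 //.
apply: le_trans (ltW (archi_boundP _)) _; last by rewrite ler_nat.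
by rewrite divr_ge0 ?sqr_ge0.
Qed.

Theorem proposition2p1 (R : realType) (alpha kappa : nat)
    (alpha_gt0 : (0 < alpha)%N) (kappa_gt0 : (0 < kappa)%N)
    (kappa_lt : (kappa < nth_prime alpha)%N) :
  (fun n : nat => gamma_seq R alpha kappa n) =o_\oo (fun n : nat => n%:R ^+ 2 : R).
Proof.
apply/eqoP => eps eps_gt0.
have lt_p i : (kappa < nth_prime (alpha + i))%N.
  by apply: leq_trans kappa_lt (nth_prime_homo _ _ _); rewrite leq_addr.
have p_large : exists N, forall i, (N <= i ->
    2 * kappa * i.+1 <= nth_prime (alpha + i))%N.
  have [N HN] := nth_prime_superlinear (2 * kappa).
  exists N => i le_i.
  apply: leq_trans (HN _ _); last exact: leq_trans (leq_addl _ _).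
  by rewrite leq_mul2l -[i.+1]add1n leq_add2r alpha_gt0 orbT.
(* gamma_n <= c * n * P with P the product, so P <= (eps / c) * m suffices. *)
pose c : R := 2 * (kappa%:R + 1).
have c_gt0 : 0 < c by rewrite mulr_gt0 // ltr_wpDl.
have [N HN] :=
  prod_ratio_sublinear R kappa _ lt_p p_large _ (divr_gt0 eps_gt0 c_gt0).
exists (N * kappa)%N => // n /= le_n.
have le_m : (N <= n %/ kappa)%N by rewrite leq_divRL.
have {HN} := HN _ le_m.
rewrite /gamma_seq; set m := (n %/ kappa)%N in le_m *.
set P := \prod_(_ <= _ < _) _ => le_P.
have P_ge0 : 0 <= P.
  by apply: prodr_ge0 => i _; rewrite divr_ge0 // subr_ge0 ler_nat ltnW.
set p : R := (nth_prime (alpha + m))%:R.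
have -> : p - n%:R + kappa%:R * m%:R = p - (n %% kappa)%:R.
  by rewrite {1}(divn_eq n kappa) natrD natrM -/m; ring.
have le_r : (n %% kappa)%:R <= kappa%:R :> R by rewrite ler_nat ltnW // ltn_mod.
have p_ge : kappa%:R + 1 <= p by rewrite natr1 ler_nat.
move: le_r p_ge; set r := (n %% kappa)%:R; set k : R := kappa%:R => le_r p_ge.
have k_ge0 : 0 <= k by [].
have n_ge0 : 0 <= n%:R :> R by [].
have p_frac : p / (p - r) <= k + 1.
  rewrite ler_pdivrMr; last by lra.
  (* (k + 1) (p - r) - p = k (p - r - 1) + (k - r). *)
  by have : 0 <= k * (p - r - 1) by [apply: mulr_ge0; lra]; lra.
have p_frac_ge0 : 0 <= p / (p - r) by apply: divr_ge0; lra.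
have -> : 2 * n%:R * p / (p - r) * P = 2 * n%:R * (p / (p - r) * P).
  by rewrite !mulrA.
rewrite (ger0_norm (exprn_ge0 2 n_ge0)) ger0_norm; last first.
  by apply: mulr_ge0; apply: mulr_ge0.
have le_mn : m%:R <= n%:R :> R by rewrite ler_nat leq_div.
apply: (@le_trans _ _ (2 * n%:R * ((k + 1) * (eps / c * m%:R)))).
  by rewrite ler_wpM2l ?mulr_ge0 // ler_pM.
have -> : 2 * n%:R * ((k + 1) * (eps / c * m%:R)) = eps * (n%:R * m%:R).
  by rewrite /c -/k; field; rewrite -/k; lra.
by rewrite expr2 ler_pM2l // ler_wpM2l.
Qed.
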